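(* For every positive integer $n$, $$ c_n\geq \frac{1}{\sqrt{\frac{1}{25}\varphi^{-4n}+\frac{3+(-1)^n}{25}\varphi^{-2n}-\frac{2}{5\sqrt{5}}n\varphi^{-2n}+\frac{13(-1)^n-33}{50}+n+\frac{3+(-1)^n}{25}\varphi^{2n}+\frac{2}{5\sqrt{5}}n\varphi^{2n}+\frac{1}{25}\varphi^{4n}}}, $$ where $\varphi=\frac{1+\sqrt5}{2}$ denotes the golden ratio.
   Context: For a positive integer $n$, let $K_n$ denote the (finite) set of all nonsingular $n\times n$ lower triangular $(0,1)$-matrices, i.e., lower triangular matrices with all entries in $\{0,1\}$ that are invertible as real matrices (equivalently, all diagonal entries equal $1$). Define $$ c_n=\min\{\lambda\mid \lambda\text{ is an eigenvalue of }XX^{\mathrm T},\ X\in K_n\}. $$ *)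

(* Defs.v *)
From HB Require Import structures.
From mathcomp Require Import all_boot all_order all_algebra.
From mathcomp Require Import all_classical all_reals.

Set Implicit Arguments.
Unset Strict Implicit.
Unset Printing Implicit Defensive.

Import Order.TTheory GRing.Theory Num.Theory.

Local Open Scope classical_set_scope.
Local Open Scope ring_scope.

Definition golden_ratio (R : realType) : R := (1 + Num.sqrt 5) / 2.

Definition K (R : realType) (n : nat) : set 'M[R]_n :=
  [set X | [/\ is_trig_mx X,
               (forall i j, X i j = 0 \/ X i j = 1) &
               X \in unitmx]].

Arguments K : clear implicits.

(* [eigenvalue] uses row eigenvectors, which is immaterial since X *m X^T is
   symmetric; for the same reason all of its eigenvalues lie in R. *)
Definition gram_eigenvalues (R : realType) (n : nat) : set R :=
  [set lambda | exists2 X, K R n X & eigenvalue (X *m X^T) lambda].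

Arguments gram_eigenvalues : clear implicits.

Definition is_min (R : realType) (S : set R) (m : R) : Prop :=
  S m /\ forall x, S x -> m <= x.

(* The default value 0 is never used when n is positive: see [c_is_min]. *)
Definition c (R : realType) (n : nat) : R :=
  xget 0 [set m | is_min (gram_eigenvalues R n) m].

Lemma finite_K (R : realType) (n : nat) : finite_set (K R n).
Proof.
pose f (B : 'M[bool]_n) : 'M[R]_n := \matrix_(i, j) (B i j)%:R.
apply: (@sub_finite_set _ _ [set f B | B in [set: 'M[bool]_n]]); last first.
  exact/finite_image/finite_finset.
move=> X [_ X01 _]; exists (\matrix_(i, j) (X i j == 1)) => //.
apply/matrixP => i j; rewrite !mxE.
by case: (X01 i j) => ->; rewrite ?eqxx // eq_sym oner_eq0.
Qed.

Lemma finite_gram_eigenvalues (R : realType) (n : nat) :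
  finite_set (gram_eigenvalues R n).
Proof.
rewrite (_ : gram_eigenvalues R n =
    \bigcup_(X in K R n) [set l | eigenvalue (X *m X^T) l]); last first.
  by apply/seteqP; split=> l [X]; exists X.
apply: bigcup_finite; first exact: finite_K.
move=> X _; have p0 : char_poly (X *m X^T) != 0.
  exact/monic_neq0/char_poly_monic.
have [r rE] : {r : seq R | forall l, root (char_poly (X *m X^T)) l -> l \in r}.
  apply/cid; apply: contrapT => H.
  have H' (k : nat) : exists s : seq R, [/\ uniq s, size s = k &
      all (root (char_poly (X *m X^T))) s].
    elim: k => [|k [s [us ss rs]]]; first by exists [::].
    apply: contrapT => Hk; apply: H; exists s => l rl; apply: contrapT.
    move=> /negP ls; apply: Hk; exists (l :: s); split => /=.
    - by rewrite ls us.
    - by rewrite ss.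
    - by rewrite rl rs.
  have [s [us ss rs]] := H' (size (char_poly (X *m X^T))).
  by have := max_poly_roots p0 rs us; rewrite ss ltnn.
apply: (@sub_finite_set _ _ [set` r]); last exact: finite_seq.
by move=> l /=; rewrite eigenvalue_root_char; exact: rE.
Qed.

Lemma gram_eigenvalues1 (R : realType) (n : nat) :
  (0 < n)%N -> (gram_eigenvalues R n) 1.
Proof.
case: n => // n _; exists 1%:M.
  split; first exact: scalar_mx_is_trig.
    by move=> i j; rewrite mxE; case: (i == j); [right|left].
  exact: unitmx1.
rewrite trmx1 mulmx1; apply/eigenvalueP; exists (const_mx 1).
  by rewrite mulmx1 scale1r.
apply/eqP => /rowP /(_ ord0) /eqP; by rewrite !mxE oner_eq0.
Qed.

Lemma c_is_min (R : realType) (n : nat) :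
  (0 < n)%N -> is_min (gram_eigenvalues R n) (c R n).
Proof.
move=> n0; rewrite /c; apply: (@xgetPex _ 0 [set m | is_min _ m]).
have /finite_seqP[s sE] := finite_gram_eigenvalues R n.
have := gram_eigenvalues1 R n0; rewrite sE /is_min /=.
move: (1) => x; elim: s x {sE} => [//|a s IH] x _.
case: s IH => [_|b s IH].
  by exists a => /=; split; [exact: mem_head|move=> y; rewrite inE => /eqP->].
have [m [ms mle]] := IH b (mem_head _ _).
have [am|ma] := leP a m.
  exists a; split; first exact: mem_head.
  by move=> y /=; rewrite inE => /orP[/eqP-> //|/mle]; exact: le_trans.
exists m; split; first by rewrite /= inE ms orbT.
by move=> y /=; rewrite inE => /orP[/eqP->|/mle//]; exact: ltW.
Qed.

(* Main.v *)
Require Import Defs.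
From mathcomp Require Import all_boot all_order all_algebra.
From mathcomp Require Import all_classical all_reals.
From mathcomp Require Import ring lra.

Import Order.TTheory GRing.Theory Num.Theory.

Local Open Scope ring_scope.

(** Let [X] be in [K n], let [l] be an eigenvalue of [X X^T], and put
    [Z = X^-1], so that [(X X^T)^-1 = Z^T Z].  Since [1 / l] is an eigenvalue of
    [Z^T Z], it is at most the Frobenius norm of [Z^T Z]; hence it suffices to
    bound the entries of [Z] ([gram_eigenvalue_bound], [frob_sqr_gram_le]).

    Forward substitution expresses each entry of a column of [Z], apart from
    the diagonal 1, as minus a sum of some of the entries above it.  So it is
    at most, in absolute value, the sum of the positive entries above it or the
    sum of the absolute values of the negative ones.  One new entry enlarges
    only one of these two sums, and by at most the other one, which is
    Fibonacci growth: [|Z i j|] is at most [W i j = (i == j) + fib (i - j)],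
    with truncated subtraction ([mass_growth], [abs_invmx_trig01_le]).

    It remains to see that the square of the Frobenius norm of [W^T W] is the
    expression under the square root ([golden_ratio_majorant_frob]).  As [W i j]
    depends only on [i - j], passing from size [n] to size [n + 1] borders the
    Gram matrix with one new row and column ([majorant_frobS]), whose entries
    have closed forms ([majorant_gram0]).  Their squares sum to a polynomial in
    [n], [fib n], [fib n.+1] and [(-1)^n] ([sum_majorant_gram0_sqr]), so a
    closed form for the Frobenius norm follows by induction ([majorant_frobE])
    and Binet's formula turns it into powers of the golden ratio. *)

(** * Sums of products of Fibonacci numbers *)

Fixpoint fib (n : nat) : nat :=
  if n is n'.+1 then if n' is n''.+1 then (fib n' + fib n'')%N else 1%N
  else 0%N.

Arguments fib : simpl never.

Lemma fib0 : fib 0 = 0%N. Proof. by []. Qed.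

Lemma fib1 : fib 1 = 1%N. Proof. by []. Qed.

Lemma fibSS (n : nat) : fib n.+2 = (fib n.+1 + fib n)%N.
Proof. by []. Qed.

Section FibonacciSums.
Variable R : comNzRingType.

Local Notation F k := ((fib k)%:R : R).

Lemma fibSSr (n : nat) : F n.+2 = F n.+1 + F n.
Proof. by rewrite fibSS natrD. Qed.

Lemma sign_odd_natr (n : nat) : (-1) ^+ n = 1 - 2 * (odd n)%:R :> R.
Proof. by rewrite -signr_odd; case: (odd n); rewrite /=; ring. Qed.

Lemma fib_cassini (n : nat) :
  F n.+1 ^+ 2 = F n.+1 * F n + F n ^+ 2 + (-1) ^+ n.
Proof.
elim: n => [|n IHn]; first by rewrite fib0 fib1; ring.
by rewrite fibSSr [(-1) ^+ _.+1]exprS; move: ((-1) ^+ n) IHn => e IHn; ring: IHn.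
Qed.

(** D'Ocagne's identity; Cassini's identity [fib_cassini] is essentially the
    case [d = 1].  Here it supplies the correction depending on parity in
    [sum_fib_shift]. *)
Lemma fib_docagne (d m : nat) :
  F (m + d) * F m.+1 = F (m + d).+1 * F m + (-1) ^+ m * F d.
Proof.
elim: m => [|m IHm]; first by rewrite add0n fib0 fib1; ring.
by rewrite addSn !fibSSr [(-1) ^+ _.+1]exprS; move: ((-1) ^+ m) IHm => e IHm; ring: IHm.
Qed.

Lemma sum_fib_shift (d m : nat) :
  \sum_(t < m.+1) F (t + d) * F t = F m * F (m + d).+1 - (odd m)%:R * F d.
Proof.
elim: m => [|m IHm]; first by rewrite big_ord_recr big_ord0 /= fib0; ring.
rewrite big_ord_recr IHm /= addSn !fibSSr.
by move: (fib_docagne d m); rewrite sign_odd_natr; case: (odd m) => /= H; ring: H.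
Qed.

Lemma sum_fib_sqr (m : nat) : \sum_(t < m.+1) F t ^+ 2 = F m * F m.+1.
Proof.
elim: m => [|m IHm]; first by rewrite big_ord_recr big_ord0 /= fib0; ring.
by rewrite big_ord_recr IHm /= fibSSr; ring.
Qed.

(** The sum over even [m] satisfies the Fibonacci recurrence with forcing term
    [fib k.+1] for odd [k].  The factor 20 clears the denominators of the
    solution, so that the identity makes sense in every commutative ring. *)
Lemma fib_even_conv (n : nat) :
  20 * \sum_(m < n.+1) (~~ odd m)%:R * (F m * F (n - m)) =
    2 * (n%:R * (2 * F n.+1 - F n) - F n) - 5 * (1 + (-1) ^+ n) * F n.
Proof.
(* Two consecutive values are carried, as the recurrence has order two. *)
pose C k := \sum_(m < k.+1) (~~ odd m)%:R * (F m * F (k - m)).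
have C_rec k : C k.+2 = C k.+1 + C k + (odd k)%:R * F k.+1.
  have -> : C k.+2 = \sum_(m < k.+1) (~~ odd m)%:R * (F m * F (k - m).+2)
                     + (odd k)%:R * F k.+1.
    rewrite /C [LHS]big_ord_recr [X in X + _ = _]big_ord_recr /=.
    rewrite subnn subSnn fib0 fib1 negbK mulr0n mulr1n !mulr0 mulr1 addr0; congr (_ + _).
    apply: eq_bigr => i _; have ik : (i <= k)%N by rewrite -ltnS.
    by rewrite !subSn // leqW.
  rewrite /C [X in _ = X + _ + _]big_ord_recr /= subnn fib0 mulr0n !mulr0 addr0 -big_split.
  congr (_ + _); apply: eq_bigr => i _ /=.
  by rewrite subSn -1?ltnS // fibSSr -!mulrDr.
suff: 20 * C n = 2 * (n%:R * (2 * F n.+1 - F n) - F n)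
                  - 5 * (1 + (-1) ^+ n) * F n /\
  20 * C n.+1 = 2 * (n.+1%:R * (2 * F n.+2 - F n.+1) - F n.+1)
                  - 5 * (1 + (-1) ^+ n.+1) * F n.+1 by case.
elim: n => [|n [IH0 IH1]].
  rewrite /C !big_ord_recr !big_ord0 /= ?fibSSr fib0 fib1; split; ring.
split=> //; rewrite C_rec !mulrDr IH0 IH1 !fibSSr ![(-1) ^+ _.+1]exprS !sign_odd_natr.
by case: (odd n) => /=; ring.
Qed.

(** The indices [n - m] with [m] even are those of the parity of [n], so going
    from [k] to [k.+2] only adds [fib k.+2 ^+ 2]. *)
Lemma fib_same_parity_sqr (n : nat) :
  5 * \sum_(m < n.+1) (~~ odd m)%:R * F (n - m) ^+ 2 =
    F n.+1 * (2 * F n + F n.+1) - (-1) ^+ n * n.+1%:R.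
Proof.
pose D k := \sum_(m < k.+1) (~~ odd m)%:R * F (k - m) ^+ 2.
have D_rec k : D k.+2 = F k.+2 ^+ 2 + D k.
  rewrite /D 2!big_ord_recl /= subn0 mul1r mul0r add0r; congr (_ + _).
  by apply: eq_bigr => i _; rewrite /bump /= !add1n /= negbK !subSS.
suff: 5 * D n = F n.+1 * (2 * F n + F n.+1) - (-1) ^+ n * n.+1%:R /\
  5 * D n.+1 = F n.+2 * (2 * F n.+1 + F n.+2) - (-1) ^+ n.+1 * n.+2%:R by case.
elim: n => [|n [IH0 IH1]].
  by rewrite /D !big_ord_recr !big_ord0 /= ?fibSSr fib0 fib1; split; ring.
split=> //; rewrite D_rec mulrDr IH0 !fibSSr ![(-1) ^+ _.+1]exprS.
by move: ((-1) ^+ n) (fib_cassini n) => e H; ring: H.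
Qed.


(** * The Gram matrix of the Fibonacci majorant *)

(** The subtraction truncates, so the entries above the diagonal are 0 and the
    diagonal ones are 1. *)
Definition fib_majorant (i j : nat) : R := (i == j)%:R + F (i - j).

Local Notation W := fib_majorant.

Definition majorant_gram (n i j : nat) : R := \sum_(k < n) W k i * W k j.

Definition majorant_frob (n : nat) : R :=
  \sum_(i < n) \sum_(j < n) majorant_gram n i j ^+ 2.

Lemma majorant_gramC (n i j : nat) : majorant_gram n i j = majorant_gram n j i.
Proof. by apply: eq_bigr => k _; rewrite mulrC. Qed.

(** [W i.+1 j.+1 = W i j] and row 0 of [W] vanishes beyond column 0, so the
    Gram matrix of size [n] is the lower right block of that of size [n.+1]. *)
Lemma majorant_gramSS (n i j : nat) :
  majorant_gram n.+1 i.+1 j.+1 = majorant_gram n i j.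
Proof.
rewrite /majorant_gram big_ord_recl /= {1}/W sub0n fib0 addr0 mul0r add0r.
by apply: eq_bigr.
Qed.

Lemma sum_kronecker (n d : nat) (G : nat -> R) : (d < n)%N ->
  \sum_(k < n) (k == d :> nat)%:R * G k = G d.
Proof.
move=> dn; rewrite (bigD1 (Ordinal dn)) //= eqxx mul1r big1 ?addr0 // => k.
by rewrite -val_eqE /= => /negPf->; rewrite mul0r.
Qed.

(** The new row.  The Kronecker symbol in column 0 of [W] picks [W 0 d], the
    one in column [d] picks [fib d], and what is left is a shifted sum of
    products, evaluated by [sum_fib_shift].  For odd [n - d] its correction
    cancels [fib d]. *)
Lemma majorant_gram0 (n d : nat) : (d <= n)%N ->
  majorant_gram n.+1 0 d =
    (d == 0)%:R + (F (n - d) * F n.+1 + (~~ odd (n - d))%:R * F d).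
Proof.
move=> dn; rewrite /majorant_gram.
under eq_bigr => k _.
  rewrite /fib_majorant subn0 mulrDl [F k * _]mulrDr [F k * (_ == _)%:R]mulrC.
  over.
rewrite !big_split /= (sum_kronecker _ _ (fun k => W k d)) //.
rewrite (sum_kronecker _ _ (fun k => F k)) // {1}/W sub0n fib0 addr0 [0 == d]eq_sym.
congr (_ + _).
(* The terms with [k < d] vanish by truncation; the others are reindexed. *)
rewrite -(big_mkord xpredT (fun k => F k * F (k - d))).
rewrite (@big_cat_nat _ _ _ d) //=; last exact: leqW.
rewrite big_nat big1 ?add0r => [|k /andP[_ kd]]; last first.
  by rewrite (eqP (ltnW kd)) fib0 mulr0.
rewrite -{2}[d]add0n big_addn subSn // big_mkord.
under eq_bigr do rewrite addnK.
by rewrite sum_fib_shift subnK //; case: (odd _) => /=; ring.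
Qed.

(** The new row and column are equal and share the corner entry, which is
    therefore counted once too often in the doubled sum. *)
Lemma majorant_frobS (n : nat) :
  majorant_frob n.+1 = majorant_frob n
    + 2 * \sum_(d < n.+1) majorant_gram n.+1 0 d ^+ 2
    - majorant_gram n.+1 0 0 ^+ 2.
Proof.
rewrite /majorant_frob big_ord_recl [in RHS]big_ord_recl.
under [X in _ + X = _]eq_bigr => i _.
  rewrite big_ord_recl /= majorant_gramC.
  under eq_bigr do rewrite majorant_gramSS.
  over.
rewrite big_split /= [in LHS]big_ord_recl /=; ring.
Qed.

(** With [m = n - d], a new entry is
    [fib m * fib n.+1 + (~~ odd m) * fib (n - m)], up to the extra 1 for
    [d = 0]; squaring it produces the three sums of the previous part. *)
Lemma sum_majorant_gram0_sqr (n : nat) :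
  20 * \sum_(d < n.+1) majorant_gram n.+1 0 d ^+ 2 =
    20 * (1 + 2 * (F n * F n.+1) + F n.+1 ^+ 3 * F n)
    + 2 * F n.+1 * (2 * (n%:R * (2 * F n.+1 - F n) - F n)
                    - 5 * (1 + (-1) ^+ n) * F n)
    + 4 * (F n.+1 * (2 * F n + F n.+1) - (-1) ^+ n * n.+1%:R).
Proof.
pose h m := F m * F n.+1 + (~~ odd m)%:R * F (n - m).
have -> : \sum_(d < n.+1) majorant_gram n.+1 0 d ^+ 2
    = 1 + 2 * (F n * F n.+1) + \sum_(m < n.+1) h m ^+ 2.
  rewrite [X in _ = _ + X](reindex_inj rev_ord_inj) /=.
  transitivity (\sum_(d < n.+1) ((d == 0 :> nat)%:R * (1 + 2 * h (n - d)%N)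
                                 + h (n - d)%N ^+ 2)).
    apply: eq_bigr => d _; have dn : (d <= n)%N by rewrite -ltnS.
    rewrite majorant_gram0 // /h subKn //.
    by case: (_ == _) => /=; ring.
  rewrite big_split /= (sum_kronecker _ _ (fun d => 1 + 2 * h (n - d)%N)) //.
  rewrite {1}/h subn0 subnn fib0 mulr0 addr0; congr (_ + _).
have -> : \sum_(m < n.+1) h m ^+ 2 = F n.+1 ^+ 2 * \sum_(m < n.+1) F m ^+ 2
    + 2 * F n.+1 * (\sum_(m < n.+1) (~~ odd m)%:R * (F m * F (n - m)))
    + \sum_(m < n.+1) (~~ odd m)%:R * F (n - m) ^+ 2.
  rewrite !mulr_sumr -!big_split /=; apply: eq_bigr => m _.
  by rewrite /h; case: (odd m) => /=; ring.
by rewrite sum_fib_sqr -fib_even_conv -fib_same_parity_sqr; ring.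
Qed.

(** The quantity [F n * (2 * F n.+1 - F n)] is [fib (2 * n)].  In the induction
    step both sides are polynomials in [n], [fib n], [fib n.+1], [(-1)^n], equal
    modulo Cassini's identity once the parity of [n] is fixed. *)
Lemma majorant_frobE (n : nat) :
  10 * majorant_frob n =
    2 * (F n * (2 * F n.+1 - F n)) ^+ 2 + 2 * (3 + (-1) ^+ n) * F n ^+ 2
    + 4 * n%:R * (F n * (2 * F n.+1 - F n)) + 10 * n%:R
    + 5 * ((-1) ^+ n - 1).
Proof.
elim: n => [|n IHn].
  by rewrite /majorant_frob big_ord0 fib0 fib1; ring.
rewrite majorant_frobS.
set S := \sum_(d < _) _; set g := majorant_gram _ _ _.
have -> : 10 * (majorant_frob n + 2 * S - g ^+ 2)
  = 10 * majorant_frob n + 20 * S - 10 * g ^+ 2 by ring.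
rewrite IHn /S sum_majorant_gram0_sqr /g majorant_gram0 // subn0 fib0 fibSSr.
rewrite [(-1) ^+ _.+1]exprS.
move: (fib_cassini n); rewrite sign_odd_natr.
by case: (odd n) => /= H; ring: H.
Qed.

End FibonacciSums.

(** * Entries of the inverse of a triangular (0,1)-matrix *)

Section InverseEntries.
Variable R : realFieldType.

Local Notation F k := ((fib k)%:R : R).

Definition pos_mass (z : nat -> R) (i : nat) : R := \sum_(k < i) Num.max (z k) 0.

Definition neg_mass (z : nat -> R) (i : nat) : R :=
  \sum_(k < i) Num.max (- z k) 0.

(** Let [P] and [N] be the masses of the positive and of the negative entries
    before [i].  For [i > j], a new positive entry is at most [N], and a new
    negative one is at least [- P], so [(P, N)] becomes at most [(P + N, N)] or
    [(P, N + P)].  From [(1, 0)] after entry [j], this keeps the larger mass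
    below a Fibonacci number and the total mass below the next one.  In the
    last bound, the next one is written as a sum so that for [i <= j], where
    both masses are zero, it reads 0 and not 1. *)
Lemma mass_growth (n j : nat) (z : nat -> R) :
  (forall i, (i < n)%N ->
     - pos_mass z i <= z i - (i == j)%:R <= neg_mass z i) ->
  forall i, (i <= n)%N ->
    [/\ pos_mass z i <= F (i - j), neg_mass z i <= F (i - j) &
        pos_mass z i + neg_mass z i <= F (i - j) + F (i - j).-1].
Proof.
move=> zP; elim=> [|i IHi] lt_in.
  by rewrite /pos_mass /neg_mass !big_ord0 sub0n fib0; split; lra.
have [] := IHi (ltnW lt_in); have /andP[] := zP _ lt_in.
have : 0 <= pos_mass z i by apply: sumr_ge0 => k _; rewrite le_max lexx orbT.
have : 0 <= neg_mass z i by apply: sumr_ge0 => k _; rewrite le_max lexx orbT.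
have -> : pos_mass z i.+1 = pos_mass z i + Num.max (z i) 0.
  by rewrite /pos_mass big_ord_recr.
have -> : neg_mass z i.+1 = neg_mass z i + Num.max (- z i) 0.
  by rewrite /neg_mass big_ord_recr.
move: (pos_mass z i) (neg_mass z i) (z i) => P N x N0 P0.
case: (ltngtP i j) => [lt_ij|lt_ji|->] /=.
- rewrite (eqP (ltnW lt_ij)) (eqP lt_ij) fib0 => xP xN PF NF _.
  have -> : x = 0 by lra.
  by rewrite oppr0 maxxx; split; lra.
- rewrite subSn 1?ltnW // -(subnK lt_ji) addnS -addSn addnK /= !fibSSr.
  move=> xP xN PF NF PNF; have [x0|/ltW x0] := lerP 0 x.
    by rewrite max_r; [split; lra|lra].
  by rewrite max_l; [split; lra|lra].
- rewrite subnn subSnn fib0 fib1 => xP xN PF NF _.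
  have -> : x = 1 by lra.
  by rewrite max_l ?max_r; [split; lra|lra|lra].
Qed.

Lemma abs_le_fib_majorant (n j : nat) (z : nat -> R) :
  (forall i, (i < n)%N ->
     - pos_mass z i <= z i - (i == j)%:R <= neg_mass z i) ->
  forall i, (i < n)%N -> `|z i| <= fib_majorant R i j.
Proof.
move=> zP i lt_in; have [PF NF _] := mass_growth n j z zP i (ltnW lt_in).
have /andP[zl zu] := zP i lt_in.
rewrite /fib_majorant ler_norml; apply/andP; split.
  by case: (i == j) zl => /=; lra.
by case: (i == j) zu => /=; lra.
Qed.

Lemma trig01_diag (n : nat) (X : 'M[R]_n) (i : 'I_n) :
  is_trig_mx X -> (forall i j, X i j = 0 \/ X i j = 1) -> X \in unitmx ->
  X i i = 1.
Proof.
move=> trX X01; rewrite unitmxE det_trig // unitfE => /prodf_neq0 /(_ i isT).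
by case: (X01 i i) => -> //; rewrite eqxx.
Qed.

(** Row [k] of [X X^-1 = 1] is forward substitution: the entry [k] of column
    [j] of [X^-1] is [(k == j)] minus a sum of earlier entries with
    coefficients 0 or 1, which lies between [- pos_mass] and [neg_mass]. *)
Lemma abs_invmx_trig01_le (n : nat) (X : 'M[R]_n) (i j : 'I_n) :
  is_trig_mx X -> (forall i j, X i j = 0 \/ X i j = 1) -> X \in unitmx ->
  `|invmx X i j| <= fib_majorant R i j.
Proof.
case: n X i j => [|n] X i j trX X01 Xu; first by case: i.
pose z k : R := invmx X (inord k) j.
have -> : invmx X i j = z i by rewrite /z inord_val.
apply: (abs_le_fib_majorant n.+1 j z) => // k lt_kn.
have zk : z k - (k == j)%:R = - \sum_(l < k) X (inord k) (inord l) * z l.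
  have /matrixP/(_ (inord k) j) := mulmxV Xu; rewrite !mxE -val_eqE /= inordK //.
  move=> <-.
  transitivity (z k - \sum_(0 <= l < n.+1) X (inord k) (inord l) * z l).
    rewrite big_mkord; congr (_ - _).
    by apply: eq_bigr => l _; rewrite /z inord_val.
  have upper0 : \sum_(k.+1 <= l < n.+1) X (inord k) (inord l) * z l = 0.
    rewrite big_nat big1 // => l /andP[lt_kl lt_ln].
    by move/is_trig_mxP: (trX) => ->; rewrite ?mul0r // !inordK.
  rewrite (@big_cat_nat _ _ _ k.+1) //= upper0 addr0 big_nat_recr //=.
  by rewrite trig01_diag // big_mkord; ring.
have bnd l : - Num.max (- z l) 0 <= X (inord k) (inord l) * z l <= Num.max (z l) 0.
  case: (X01 (inord k) (inord l)) => ->; rewrite ?mul0r ?mul1r.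
    by rewrite oppr_le0 !le_max lexx !orbT.
  by rewrite lerNl !le_max !lexx.
rewrite zk lerN2 lerNl /neg_mass /pos_mass -sumrN; apply/andP; split.
  by apply: ler_sum => l _; case/andP: (bnd l).
by apply: ler_sum => l _; case/andP: (bnd l).
Qed.

End InverseEntries.

(** * From entries of the inverse to eigenvalues *)

Section SpectralBound.
Variable R : realFieldType.

(** Lagrange's identity: the difference of the two sides is half of the double
    sum of the squares [(a i * b j - a j * b i) ^+ 2]. *)
Lemma cauchy_schwarz_sum (n : nat) (a b : 'I_n -> R) :
  (\sum_i a i * b i) ^+ 2 <= (\sum_i a i ^+ 2) * (\sum_i b i ^+ 2).
Proof.
have : 0 <= \sum_i \sum_j (a i * b j - a j * b i) ^+ 2.
  by apply: sumr_ge0 => i _; apply: sumr_ge0 => j _; exact: sqr_ge0.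
suff -> : \sum_i \sum_j (a i * b j - a j * b i) ^+ 2 =
  2 * ((\sum_i a i ^+ 2) * (\sum_i b i ^+ 2) - (\sum_i a i * b i) ^+ 2) by lra.
transitivity (\sum_i \sum_j (a i ^+ 2 * b j ^+ 2 + b i ^+ 2 * a j ^+ 2
                             - 2 * ((a i * b i) * (a j * b j)))).
  by apply: eq_bigr => i _; apply: eq_bigr => j _; ring.
under eq_bigr do rewrite sumrB big_split /= -!mulr_sumr.
rewrite sumrB big_split /= -mulr_sumr -!mulr_suml; ring.
Qed.

Definition frob_sqr {n : nat} (B : 'M[R]_n) : R := \sum_i \sum_j B i j ^+ 2.

Lemma row_sqr_gt0 {n : nat} (v : 'rV[R]_n) : v != 0 -> 0 < \sum_j v 0 j ^+ 2.
Proof.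
move=> v0; rewrite lt0r sumr_ge0 ?andbT => [|j _]; last exact: sqr_ge0.
apply: contra v0 => /eqP; move/psumr_eq0P => H; apply/eqP/rowP => j.
by apply/eqP; rewrite mxE -sqrf_eq0 H // => k _; exact: sqr_ge0.
Qed.

(** The spectral radius is at most the Frobenius norm.  The eigenvalue equation
    is written as [v = l (v B)] because [l] is the eigenvalue of the inverse
    of [B]. *)
Lemma frob_sqr_ge_eigen (n : nat) (B : 'M[R]_n) (v : 'rV[R]_n) (l : R) :
  v != 0 -> v = l *: (v *m B) -> 1 <= l ^+ 2 * frob_sqr B.
Proof.
move=> v0 vE; have v_gt0 := row_sqr_gt0 _ v0.
rewrite -(ler_pM2l v_gt0) mulr1 mulrCA /frob_sqr exchange_big mulr_sumr mulr_sumr.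
apply: ler_sum => j _; rewrite {1}vE !mxE exprMn ler_wpM2l ?sqr_ge0 //.
exact: (cauchy_schwarz_sum _ (fun i => v 0 i) (fun i => B i j)).
Qed.

Lemma gram_eigenvalue_ge0 (n : nat) (X : 'M[R]_n) (v : 'rV[R]_n) (l : R) :
  v != 0 -> v *m (X *m X^T) = l *: v -> 0 <= l.
Proof.
move=> v0 /(congr1 (fun w => (w *m v^T) 0 0)).
rewrite mulmxA -mulmxA -trmx_mul -scalemxAl mxE [in RHS]mxE [in RHS]mxE => E.
rewrite -(pmulr_lge0 l (row_sqr_gt0 _ v0)).
suff -> : l * \sum_j v 0 j ^+ 2 = \sum_j (v *m X) 0 j ^+ 2.
  by apply: sumr_ge0 => j _; exact: sqr_ge0.
rewrite [RHS](eq_bigr (fun j => (v *m X) 0 j * (v *m X)^T j 0)) => [|j _].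
  rewrite E; congr (_ * _); apply: eq_bigr => j _; rewrite mxE; ring.
by rewrite [_^T _ _]mxE.
Qed.

Lemma gram_eigenvalue_bound (n : nat) (X : 'M[R]_n) (l : R) :
  X \in unitmx -> eigenvalue (X *m X^T) l ->
  0 <= l /\ 1 <= l ^+ 2 * frob_sqr ((invmx X)^T *m invmx X).
Proof.
move=> Xu /eigenvalueP[v vE v0]; split; first exact: gram_eigenvalue_ge0 vE.
apply: frob_sqr_ge_eigen v0 _.
rewrite scalemxAl -vE -!mulmxA [X^T *m _]mulmxA -trmx_mul mulVmx // trmx1 mul1mx.
by rewrite mulmxV // mulmx1.
Qed.

Lemma frob_sqr_gram_le (n : nat) (Z : 'M[R]_n) :
  (forall i j, `|Z i j| <= fib_majorant R i j) ->
  frob_sqr (Z^T *m Z) <= majorant_frob R n.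
Proof.
move=> ZW; apply: ler_sum => i _; apply: ler_sum => j _.
rewrite -real_normK ?num_real // lerXn2r ?nnegrE //.
  apply: sumr_ge0 => k _; apply: mulr_ge0; exact: le_trans (normr_ge0 _) (ZW _ _).
rewrite mxE (le_trans (ler_norm_sum _ _ _)) //; apply: ler_sum => k _.
by rewrite mxE normrM ler_pM.
Qed.

End SpectralBound.

(** * Translation into powers of the golden ratio *)

Section GoldenRatio.
Variable R : realType.

Local Notation F k := ((fib k)%:R : R).

(** Binet's formula in the form [(L + sqrt 5 * F) / 2], with the Lucas number
    [L = 2 * F n.+1 - F n]. *)
Lemma golden_ratioX (n : nat) :
  golden_ratio R ^+ n = (2 * F n.+1 - F n + Num.sqrt 5 * F n) / 2.
Proof.
have s2 : Num.sqrt 5 ^+ 2 = 5 :> R by rewrite sqr_sqrtr.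
elim: n => [|n IHn]; first by rewrite fib0 fib1 expr0; field.
by rewrite exprS IHn /golden_ratio fibSSr; field: s2.
Qed.

(** The conjugate power [(L - sqrt 5 * F) / 2] is the inverse of the golden
    power up to the sign [(-1)^n], which disappears in the square. *)
Lemma golden_ratioXN (n : nat) :
  golden_ratio R ^- (2 * n) = ((2 * F n.+1 - F n - Num.sqrt 5 * F n) / 2) ^+ 2.
Proof.
have s2 : Num.sqrt 5 ^+ 2 = 5 :> R by rewrite sqr_sqrtr.
apply: mulr1_eq; rewrite mulnC exprM golden_ratioX -exprMn.
suff -> : (2 * F n.+1 - F n + Num.sqrt 5 * F n) / 2
          * ((2 * F n.+1 - F n - Num.sqrt 5 * F n) / 2) = (-1) ^+ n.
  by rewrite sqrr_sign.
by move: ((-1) ^+ n) (fib_cassini R n) => e H; field: s2 H.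
Qed.

Lemma golden_ratio_majorant_frob (n : nat) :
  1 / 25 * golden_ratio R ^- (4 * n)
  + (3 + (-1) ^+ n) / 25 * golden_ratio R ^- (2 * n)
  - 2 / (5 * Num.sqrt 5) * n%:R * golden_ratio R ^- (2 * n)
  + (13 * (-1) ^+ n - 33) / 50
  + n%:R
  + (3 + (-1) ^+ n) / 25 * golden_ratio R ^+ (2 * n)
  + 2 / (5 * Num.sqrt 5) * n%:R * golden_ratio R ^+ (2 * n)
  + 1 / 25 * golden_ratio R ^+ (4 * n) = majorant_frob R n.
Proof.
have s_neq0 : Num.sqrt 5 != 0 :> R by rewrite gt_eqF // sqrtr_gt0.
have s2 : Num.sqrt 5 ^+ 2 = 5 :> R by rewrite sqr_sqrtr.
have -> : 2 / (5 * Num.sqrt 5) = 2 * Num.sqrt 5 / 25 :> R.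
  by field: s2.
have n4 : (4 * n = 2 * n * 2)%N by rewrite mulnAC.
have -> : golden_ratio R ^- (4 * n) = (golden_ratio R ^- (2 * n)) ^+ 2.
  by rewrite exprVn -exprM n4.
rewrite golden_ratioXN n4 [_ ^+ (2 * n * 2)]exprM.
have -> : golden_ratio R ^+ (2 * n)
    = ((2 * F n.+1 - F n + Num.sqrt 5 * F n) / 2) ^+ 2.
  by rewrite mulnC exprM golden_ratioX.
apply: (mulfI (_ : 10 != 0)); first by rewrite pnatr_eq0.
rewrite majorant_frobE; move: (fib_cassini R n); rewrite sign_odd_natr.
by case: (odd n) => /= H; field: s2 H.
Qed.

End GoldenRatio.

Theorem theorem2p2 (R : realType) (n : nat) (hn : (0 < n)%N) :
  c R n >=
    1 / Num.sqrt (1 / 25 * golden_ratio R ^- (4 * n)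
                  + (3 + (-1) ^+ n) / 25 * golden_ratio R ^- (2 * n)
                  - 2 / (5 * Num.sqrt 5) * n%:R * golden_ratio R ^- (2 * n)
                  + (13 * (-1) ^+ n - 33) / 50
                  + n%:R
                  + (3 + (-1) ^+ n) / 25 * golden_ratio R ^+ (2 * n)
                  + 2 / (5 * Num.sqrt 5) * n%:R * golden_ratio R ^+ (2 * n)
                  + 1 / 25 * golden_ratio R ^+ (4 * n)).
Proof.
rewrite golden_ratio_majorant_frob.
have [[X [trX X01 Xu] eigX] _] := c_is_min R hn.
have [c_ge0 c_bound] := gram_eigenvalue_bound R n X _ Xu eigX.
have T_bound : 1 <= c R n ^+ 2 * majorant_frob R n.
  apply: le_trans c_bound _; apply: ler_wpM2l; first exact: sqr_ge0.
  by apply: frob_sqr_gram_le => i j; exact: abs_invmx_trig01_le.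
have T_gt0 : 0 < majorant_frob R n.
  rewrite lt0r; apply/andP; split.
    by apply/eqP => T0; move: T_bound; rewrite T0 mulr0 ler10.
  by apply: sumr_ge0 => i _; apply: sumr_ge0 => j _; exact: sqr_ge0.
rewrite ler_pdivrMr ?sqrtr_gt0 //.
rewrite -[X in X * _](ger0_norm c_ge0) -sqrtr_sqr -sqrtrM ?sqr_ge0 //.
by rewrite -[leLHS]sqrtr1 ler_wsqrtr.
Qed.
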